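(* Let $p$ be a prime greater than $3$. Then \[ \sum_{k=0}^{p-1}\frac{15k+4}{(-27)^k}\binom{2k}{k}^2\binom{3k}{k}\equiv 4\left(\frac{p}{3}\right)p\pmod{p^2}, \] where $\left(\frac{p}{3}\right)$ is the Legendre symbol.
   Context: The congruence is in the ring of rationals whose denominators are prime to $p$. *)

(* Defs.v *)
From mathcomp Require Import all_boot all_order all_algebra.
Set Implicit Arguments. Unset Strict Implicit. Unset Printing Implicit Defensive.
Import Order.TTheory GRing.Theory Num.Theory.
Local Open Scope ring_scope.

Definition legendre3 (a : nat) : int :=
  if (a %% 3 == 1)%N then 1 else if (a %% 3 == 2)%N then -1 else 0.

Definition congr_Zp (p : nat) (a b m : rat) : Prop :=
  exists q : rat, coprime `|denq q|%N p /\ a - b = m * q.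

(* Main.v *)
(* Write c_m = (-27)^m (2m)! / (m!^3 (3m+1)!), w_m(z) = prod_(j<m) (z-j)(z-1/3-j), and
   G(m,z) = c_m (18 z^2 - 6z - 54mz + 9m + 45m^2) w_m(z)^2.  At z = -1/3 this is the m-th
   summand of the theorem.  The functions G and
   F(m,z) = c_m (2m+1)(36z + 12 - 18m) w_m(z)^2 form a WZ pair,
     G(m,z+1) - G(m,z) = F(m,z) - F(m-1,z),
   and G(m,0) = 0, so that sum_(m<p) G(m,l) = sum_(k<l) F(p-1,k) for natural l.
   Modulo p^2 the point -1/3 may be replaced by the natural number l = (p^2-1)/3.  Finally
   F(p-1,k) = a p (6k + 5 - 3p) N_k^2, where a = -3 mod p and
   p N_k = prod_(j<p-1) (k-j)(3k-1-3j).  In each block of p consecutive k, N_k is nonzero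
   mod p for only two values of k, where Wilson's theorem gives its residue; the remaining
   sum over the blocks is elementary. *)
Require Import Defs.
From mathcomp Require Import all_boot all_order all_algebra all_field.
From mathcomp Require Import ring lra zify.
Import Order.TTheory GRing.Theory Num.Theory.
Local Open Scope ring_scope.

(** * The WZ pair *)

Definition wz_coef (m : nat) : rat :=
  (-27) ^+ m * ((2 * m)`!)%:R / ((m`! ^ 3 * (3 * m).+1`!)%N)%:R.

Definition wz_prod (z : rat) (m : nat) : rat :=
  \prod_(0 <= j < m) ((z - j%:R) * (z - 1 / 3 - j%:R)).

Definition wzG (m : nat) (z : rat) : rat :=
  wz_coef m * (18 * z ^+ 2 - 6 * z - 54 * m%:R * z + 9 * m%:R + 45 * m%:R ^+ 2)
  * wz_prod z m ^+ 2.

Definition wzF (m : nat) (z : rat) : rat :=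
  wz_coef m * (2 * m%:R + 1) * (36 * z + 12 - 18 * m%:R) * wz_prod z m ^+ 2.

Ltac natr_lin m :=
  rewrite -?[(2 * m).+2]addn2 -?[(2 * m).+1]addn1 -?[(3 * m).+4]addn4
    -?[(3 * m).+3]addn3 -?[(3 * m).+2]addn2 -?[(3 * m).+1]addn1 -?[m.+1]addn1
    !(natrM, natrX, natrD).

Lemma natr_fact_neq0 (n : nat) : (n`!)%:R != 0 :> rat.
Proof. by rewrite pnatr_eq0 -lt0n fact_gt0. Qed.

(** In c_(m+1)/c_m the factor -27 (2m+2)/(3m+3) collapses to -18. *)
Lemma wz_coefS (m : nat) :
  wz_coef m.+1 * ((m%:R + 1) ^+ 3 * (3 * m%:R + 2) * (3 * m%:R + 4)) =
  - 18 * (2 * m%:R + 1) * wz_coef m.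
Proof.
rewrite /wz_coef.
have -> : (2 * m.+1 = (2 * m).+2)%N by lia.
have -> : (3 * m.+1 = (3 * m).+3)%N by lia.
rewrite !factS exprS; natr_lin m.
have h1 := natr_fact_neq0 m; have h2 := natr_fact_neq0 (3 * m).
have h3 : 0 <= m%:R :> rat by rewrite ler0n.
field; rewrite h1 h2 /=.
repeat (apply/andP; split => //); apply: lt0r_neq0; lra.
Qed.

Lemma wz_prodS (z : rat) (m : nat) :
  wz_prod z m.+1 = wz_prod z m * ((z - m%:R) * (z - 1 / 3 - m%:R)).
Proof. by rewrite /wz_prod big_nat_recr. Qed.

Lemma wz_prod_shift (z : rat) (m : nat) :
  wz_prod (z + 1) m.+1 = (z + 1) * (z + 2 / 3) * wz_prod z m.
Proof.
rewrite /wz_prod big_nat_recl //; congr (_ * _); first by field.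
by apply: eq_bigr => j _; rewrite -natr1; congr (_ * _); ring.
Qed.

(** The recurrence for [wz_coef] and the two product rules turn both sides into c_m w_m(z)^2 times a
    rational function of m and z, so [field] decides the identity. *)
Lemma wz_pair (m : nat) (z : rat) :
  wzG m.+1 (z + 1) - wzG m.+1 z = wzF m.+1 z - wzF m z.
Proof.
rewrite /wzG /wzF wz_prod_shift wz_prodS -natr1.
have h3 : 0 <= m%:R :> rat by rewrite ler0n.
have -> : wz_coef m.+1 = - 18 * (2 * m%:R + 1) * wz_coef m /
   ((m%:R + 1) ^+ 3 * (3 * m%:R + 2) * (3 * m%:R + 4)).
  rewrite -wz_coefS mulfK //; rewrite !mulf_neq0 ?expf_neq0 //; apply: lt0r_neq0; lra.
field.
repeat (apply/andP; split => //); apply: lt0r_neq0; lra.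
Qed.

Lemma wzG_sum_shift (n : nat) (z : rat) :
  \sum_(0 <= m < n.+1) wzG m (z + 1) - \sum_(0 <= m < n.+1) wzG m z = wzF n z.
Proof.
elim: n => [|n IH].
  (* The telescoping starts without a boundary term: 18 z^2 - 6z has forward difference 36z + 12,
     which is F(0,z). *)
  rewrite !big_nat1 /wzG /wzF /wz_prod !big_geq //; ring.
by rewrite big_nat_recr //= [in X in _ - X]big_nat_recr //= opprD addrACA IH wz_pair; ring.
Qed.

Lemma wz_prod_eq0 (m : nat) : (0 < m)%N -> wz_prod 0 m = 0.
Proof. by case: m => // m _; rewrite /wz_prod big_nat_recl // subrr !mul0r. Qed.

Lemma wzG_sum_nat (n l : nat) :
  \sum_(0 <= m < n.+1) wzG m l%:R = \sum_(0 <= k < l) wzF n k%:R.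
Proof.
elim: l => [|l IH].
  rewrite [RHS]big_geq // big1 // => m _; rewrite /wzG mulr0n.
  by case: m => [|m]; rewrite ?[wz_prod 0 m.+1]wz_prod_eq0 // ?mulr0n; ring.
by rewrite [RHS]big_nat_recr //= -IH -natr1 -wzG_sum_shift; ring.
Qed.

(** The j-th factor is (3j+1)(3j+2)/9, and these numerators make up (3m)! without its multiples of
    3. *)
Lemma wz_prod_third (m : nat) :
  wz_prod (- 1 / 3) m = ((3 * m)`!)%:R / (27 ^+ m * (m`!)%:R).
Proof.
elim: m => [|m IH]; first by rewrite /wz_prod big_geq.
rewrite wz_prodS IH (_ : 3 * m.+1 = (3 * m).+3)%N; last by lia.
rewrite !factS exprS; natr_lin m.
have h1 := natr_fact_neq0 m.
have h3 : 0 <= m%:R :> rat by rewrite ler0n.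
field; rewrite h1 expf_neq0 //=.
repeat (apply/andP; split => //); apply: lt0r_neq0; lra.
Qed.

Definition wz_term (m : nat) : rat :=
  ('C(2 * m, m) ^ 2 * 'C(3 * m, m))%:R / (-27) ^+ m.

(** The polynomial factor of [wzG] at z = -1/3 is (3m+1)(15m+4), so the denominator 3m+1 found here
    cancels in the summand. *)
Lemma wz_coef_prod (m : nat) :
  wz_coef m * wz_prod (- 1 / 3) m ^+ 2 = wz_term m / (3 * m + 1)%:R.
Proof.
rewrite /wz_coef /wz_term wz_prod_third.
have e1 : ('C(2 * m, m) * (m`! * m`!) = (2 * m)`!)%N.
  by have := @bin_fact (2 * m) m; rewrite (_ : 2 * m - m = m)%N; [apply; lia | lia].
have e2 : ('C(3 * m, m) * (m`! * (2 * m)`!) = (3 * m)`!)%N.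
  by have := @bin_fact (3 * m) m; rewrite (_ : 3 * m - m = 2 * m)%N; [apply; lia | lia].
rewrite factS -e2 -e1 -addn1 !(natrM, natrX, natrD) (exprNn 27).
have h1 := natr_fact_neq0 m.
have h2 : 'C(2 * m, m)%:R != 0 :> rat by rewrite pnatr_eq0 -lt0n bin_gt0; lia.
have h3 : 'C(3 * m, m)%:R != 0 :> rat by rewrite pnatr_eq0 -lt0n bin_gt0; lia.
have h4 : 3 * m%:R + 1 != 0 :> rat by apply: lt0r_neq0; have := ler0n rat m; lra.
have h5 : (27 : rat) ^+ m != 0 by rewrite expf_neq0.
(* The sign is in the numerator on one side and in the denominator on the other, and [field] treats
   it as an atom. *)
have h6 : (-1 : rat) ^+ m = ((-1) ^+ m)^-1.
  by rewrite -exprVn invrN1.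
rewrite {1}h6.
have h7 : (-1 : rat) ^+ m != 0 by rewrite signr_eq0.
by field; rewrite h1 h2 h3 h4 h5 h7.
Qed.

(** * Rationals with denominator prime to p *)

Definition p_integral (p : nat) (q : rat) : Prop := coprime `|denq q|%N p.

(** By Gauss's lemma the reduced denominator divides every denominator, so any fraction with
    denominator prime to p will do. *)
Lemma p_integral_div (p : nat) (n : int) (d : nat) :
  (0 < d)%N -> coprime d p -> p_integral p (n%:~R / d%:R).
Proof.
move=> d0 dp; rewrite /p_integral; set q := _ / _.
have dN : (d%:R : rat) != 0 by rewrite pnatr_eq0 -lt0n.
have e : numq q * d%:Z = n * denq q.
  apply: (@intr_inj rat); rewrite !rmorphM /=.
  have -> : (numq q)%:~R = q * (denq q)%:~R :> rat.
    by rewrite -{2}[q]divq_num_den mulfVK // intr_eq0 denq_neq0.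
  by rewrite /q mulrAC mulfVK.
apply: coprime_dvdl dp.
have : (`|denq q| %| `|numq q| * d)%N.
  by rewrite -[d in X in (_ %| X)%N]absz_nat -abszM e abszM dvdn_mull.
by rewrite Gauss_dvdr // coprime_sym coprime_num_den.
Qed.

Lemma p_integralP (p : nat) (q : rat) :
  p_integral p q ->
  exists (n : int) (d : nat), [/\ (0 < d)%N, coprime d p & q = n%:~R / d%:R].
Proof.
move=> h; exists (numq q), `|denq q|%N; split => //.
  by rewrite absz_gt0 denq_neq0.
by rewrite -{1}[q]divq_num_den -[in LHS]absz_denq.
Qed.

Lemma p_integral_int (p : nat) (n : int) : p_integral p n%:~R.
Proof. by rewrite -[n%:~R]divr1; apply: (@p_integral_div p n 1); rewrite // coprime1n. Qed.

Lemma p_integral_nat (p n : nat) : p_integral p n%:R.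
Proof. exact: (@p_integral_int p n). Qed.

Lemma p_integralM (p : nat) (a b : rat) :
  p_integral p a -> p_integral p b -> p_integral p (a * b).
Proof.
move=> /p_integralP[n [d [d0 dp ->]]] /p_integralP[n' [d' [d0' dp' ->]]].
rewrite mulrACA -invfM -natrM -intrM.
by apply: p_integral_div; rewrite ?muln_gt0 ?d0 // coprimeMl dp.
Qed.

Lemma p_integralD (p : nat) (a b : rat) :
  p_integral p a -> p_integral p b -> p_integral p (a + b).
Proof.
move=> /p_integralP[n [d [d0 dp ->]]] /p_integralP[n' [d' [d0' dp' ->]]].
rewrite addf_div ?pnatr_eq0 -?lt0n // -natrM -![_%:R]/((Posz _)%:~R) -!intrM -intrD.
by apply: p_integral_div; rewrite ?muln_gt0 ?d0 // coprimeMl dp.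
Qed.

Lemma p_integralN (p : nat) (a : rat) : p_integral p a -> p_integral p (- a).
Proof. by rewrite /p_integral denqN. Qed.

Lemma p_integralB (p : nat) (a b : rat) :
  p_integral p a -> p_integral p b -> p_integral p (a - b).
Proof. by move=> ha hb; apply: p_integralD => //; apply: p_integralN. Qed.

Lemma p_integralX (p : nat) (a : rat) (n : nat) : p_integral p a -> p_integral p (a ^+ n).
Proof.
move=> ha; elim: n => [|n IH]; first exact: (@p_integral_int p 1).
by rewrite exprS; apply: p_integralM.
Qed.

Lemma p_integral_inv (p n : nat) : (0 < n)%N -> coprime n p -> p_integral p (n%:R)^-1.
Proof. by move=> n0 np; rewrite -div1r; apply: (@p_integral_div p 1). Qed.

Create HintDb pint.
#[export] Hint Resolve p_integral_int p_integral_nat p_integralM p_integralD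
  p_integralN p_integralB p_integralX : pint.

Lemma congr_Zp_sum (p : nat) (m : rat) (n : nat) (f g : nat -> rat) :
  (forall i, (i < n)%N -> congr_Zp p (f i) (g i) m) ->
  congr_Zp p (\sum_(0 <= i < n) f i) (\sum_(0 <= i < n) g i) m.
Proof.
elim: n => [|n IH] h.
  by exists 0; rewrite !big_geq // subrr mulr0; split=> //; apply: (p_integral_int p 0).
have [q [hq eq]] : congr_Zp p _ _ m := IH (fun i hi => h i (ltnW hi)).
have [r [hr er]] := h n (ltnSn n).
exists (q + r); split; first exact: p_integralD.
by rewrite !big_nat_recr //= mulrDr -eq -er; ring.
Qed.

(** * Replacing the point -1/3 by (p^2-1)/3 modulo p^2 *)

Section Approximation.
Variables (p : nat) (p_pr : prime p).

Lemma coprime_lt_prime (n : nat) : (0 < n < p)%N -> coprime n p.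
Proof. by move=> h; rewrite coprime_sym prime_coprime // gtnNdvd; lia. Qed.

(** A positive number below p^2 contains the factor p at most once. *)
Lemma p_integral_p_div (n : nat) : (0 < n < p ^ 2)%N -> p_integral p (p%:R / n%:R).
Proof.
move=> /andP[n0 np]; have p0 := prime_gt0 p_pr.
case: (boolP (p %| n)%N) => [/dvdnP[k ek]|hn].
  have k0 : (0 < k)%N by case: k ek n0 => // ->.
  have kp : (k < p)%N by rewrite ek -mulnn ltn_pmul2r in np.
  rewrite ek natrM invfM mulrCA mulfV ?mulr1 ?pnatr_eq0 -?lt0n //.
  by apply: p_integral_inv => //; apply: coprime_lt_prime; rewrite k0.
apply: p_integralM; first exact: p_integral_nat.
by apply: p_integral_inv; rewrite // coprime_sym prime_coprime.
Qed.

(* The quotient of [wz_prod z m] at z = (p^2-1)/3 by its value at z = -1/3. *)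
Definition wz_ratio (m : nat) : rat :=
  \prod_(0 <= j < m) ((1 - p%:R ^+ 2 / (3 * j + 1)%:R) * (1 - p%:R ^+ 2 / (3 * j + 2)%:R)).

Lemma wz_prod_ratio (m : nat) :
  wz_prod ((p%:R ^+ 2 - 1) / 3) m = wz_prod (- 1 / 3) m * wz_ratio m.
Proof.
elim: m => [|m IH]; first by rewrite /wz_prod /wz_ratio !big_geq // mulr1.
rewrite !wz_prodS IH [wz_ratio m.+1]/wz_ratio big_nat_recr //= -/(wz_ratio m) !(natrD, natrM).
have h := ler0n rat m.
by field; rewrite ?andbT; apply/andP; split; apply: lt0r_neq0; lra.
Qed.

(** All denominators 3j+1 and 3j+2 with j < m are below p, hence prime to p. *)
Lemma wz_ratio_modp2 (m : nat) : (3 * m < p)%N ->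
  exists2 r, p_integral p r & wz_ratio m = 1 + p%:R ^+ 2 * r.
Proof.
elim: m => [|m IH] hm.
  by exists 0; [apply: (p_integral_int p 0) | rewrite /wz_ratio big_geq // mulr0 addr0].
have [|r hr er] := IH; first by lia.
rewrite /wz_ratio big_nat_recr //= -/(wz_ratio m) er.
have inv_int n : (0 < n < p)%N -> p_integral p (n%:R^-1).
  by move=> h; apply: p_integral_inv; [lia | apply: coprime_lt_prime].
have h1 : p_integral p ((3 * m + 1)%:R^-1) by apply: inv_int; lia.
have h2 : p_integral p ((3 * m + 2)%:R^-1) by apply: inv_int; lia.
move: h1 h2; set u := _^-1; set v := _^-1 => h1 h2.
have hP : p_integral p (p%:R) by apply: p_integral_nat.
exists (r - (1 + p%:R ^+ 2 * r) * (u + v - p%:R ^+ 2 * (u * v))); last by ring.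
by auto 10 using (p_integral_int p 1) with pint.
Qed.

(** Here a denominator n may contain one p; writing p^2/n as p (p/n) saves the other. *)
Lemma wz_ratio_modp (m : nat) : (3 * m < p ^ 2)%N ->
  exists2 r, p_integral p r & wz_ratio m = 1 + p%:R * r.
Proof.
elim: m => [|m IH] hm.
  by exists 0; [apply: (p_integral_int p 0) | rewrite /wz_ratio big_geq // mulr0 addr0].
have [|r hr er] := IH; first by lia.
rewrite /wz_ratio big_nat_recr //= -/(wz_ratio m) er !expr2 -!(mulrA p%:R).
have h1 : p_integral p (p%:R / (3 * m + 1)%:R) by apply: p_integral_p_div; lia.
have h2 : p_integral p (p%:R / (3 * m + 2)%:R) by apply: p_integral_p_div; lia.
move: h1 h2; set u := _ / _; set v := _ / _ => h1 h2.
have hP : p_integral p (p%:R) by apply: p_integral_nat.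
exists (r - (1 + p%:R * r) * (u + v - p%:R * (u * v))); last by ring.
by auto 10 using (p_integral_int p 1) with pint.
Qed.

Lemma prime_dvd_fact (n : nat) : (p %| n`!)%N = (p <= n)%N.
Proof.
elim: n => [|n IH]; first by rewrite dvdn1 leqn0; have := prime_gt1 p_pr; lia.
rewrite factS Euclid_dvdM // IH; case: (ltngtP p n.+1) => [| |->]; last by rewrite dvdnn.
- by move=> h; rewrite orbC -ltnS h.
- by move=> h; rewrite gtnNdvd //=; lia.
Qed.

(** The product of the two binomials is (3m)!/m!^3, where p divides (3m)! but not m!. *)
Lemma prime_dvd_bin_prod (m : nat) : (m < p)%N -> (p <= 3 * m)%N ->
  (p %| 'C(2 * m, m) * 'C(3 * m, m))%N.
Proof.
move=> mp pm.
have e1 : ('C(2 * m, m) * (m`! * m`!) = (2 * m)`!)%N.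
  by have := @bin_fact (2 * m) m; rewrite (_ : 2 * m - m = m)%N; [apply; lia | lia].
have e2 : ('C(3 * m, m) * (m`! * (2 * m)`!) = (3 * m)`!)%N.
  by have := @bin_fact (3 * m) m; rewrite (_ : 3 * m - m = 2 * m)%N; [apply; lia | lia].
have hm : ~~ (p %| m`!)%N by rewrite prime_dvd_fact -ltnNge.
have : (p %| (3 * m)`!)%N by rewrite prime_dvd_fact.
by rewrite -e2 -e1 !Euclid_dvdM // (negPf hm) !orbF orbC.
Qed.

Lemma p_integral_div27 (n m : nat) : (3 < p)%N -> p_integral p (n%:R / (-27) ^+ m).
Proof.
move=> p3; rewrite (_ : (-27) ^+ m = (-1) ^+ m * (27 ^ m)%:R); last first.
  by rewrite natrX -exprMn mulN1r.
rewrite invfM -exprVn invrN1 mulrA -[n%:R]/((Posz n)%:~R) -[-1]/((-1)%:~R).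
rewrite -rmorphXn -intrM; apply: p_integral_div; first by rewrite expn_gt0.
by rewrite coprimeXl // (@coprimeXl 3 3) // coprime_lt_prime // p3.
Qed.

(* The coefficient of [p^2] in the polynomial factor of [wzG] is a multiple of [3m+1], which
   cancels the possible [p] in the denominator of [wz_term m / (3m+1)].  When [p <= 3m] the
   ratio is only [1] mod [p], but then [p] divides [wz_term m]. *)
Lemma wzG_approx (m : nat) : (3 < p)%N -> (m < p)%N ->
  congr_Zp p (wzG m ((p%:R ^+ 2 - 1) / 3)) ((15 * m + 4)%:R * wz_term m) (p%:R ^+ 2).
Proof.
move=> p3 mp.
have h3 : p_integral p (p%:R / (3 * m + 1)%:R) by apply: p_integral_p_div; nia.
have h0 : (3 * m%:R + 1 : rat) != 0.
  by apply: lt0r_neq0; have := ler0n rat m; lra.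
have hP : p_integral p p%:R by apply: p_integral_nat.
(* At z = (p^2-1)/3 the polynomial factor is (3m+1)(15m+4) + p^2 (2p^2 - 6(3m+1)); it is divided
   here by 3m+1. *)
have e : wzG m ((p%:R ^+ 2 - 1) / 3) =
  wz_term m * ((15 * m + 4)%:R + p%:R ^+ 2 * (2 * p%:R * (p%:R / (3 * m + 1)%:R) - 6))
   * wz_ratio m ^+ 2.
  have -> : wz_term m = wz_coef m * wz_prod (- 1 / 3) m ^+ 2 * (3 * m + 1)%:R.
    by rewrite wz_coef_prod mulfVK // natrD natrM.
  by rewrite /wzG wz_prod_ratio !(natrD, natrM); field.
have t_int : p_integral p (wz_term m) by apply: p_integral_div27.
have [|r hr er] := wz_ratio_modp m; first by nia.
move: e h3; set u := p%:R / _; set B := (15 * m + 4)%:R => e h3.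
have hB : p_integral p B by apply: p_integral_nat.
have h1 : p_integral p 1 by apply: (p_integral_int p 1).
have h2 : p_integral p 2 by apply: (p_integral_int p 2).
have h6 : p_integral p 6 by apply: (p_integral_int p 6).
have [hlt|hge] := ltnP (3 * m) p.
  have [s hs es] := wz_ratio_modp2 m hlt.
  exists (wz_term m * (B * (2 * s + p%:R ^+ 2 * s ^+ 2)
    + (2 * p%:R * u - 6) * (1 + p%:R ^+ 2 * s) ^+ 2)).
  split; last by rewrite e es; ring.
  by apply: p_integralM => //; auto 10 with pint.
have [k ek] : exists k : nat, ('C(2 * m, m) * 'C(3 * m, m) = k * p)%N.
  by have /dvdnP[k ?] := prime_dvd_bin_prod m mp hge; exists k.
have [v hv ev] : exists2 v, p_integral p v & wz_term m = p%:R * v.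
  exists (('C(2 * m, m) * k)%:R / (-27) ^+ m); first exact: p_integral_div27.
  by rewrite /wz_term expnS expn1 -mulnA ek mulnA natrM mulrA [p%:R * _]mulrC.
(* One p comes from [wz_term m] = p v, the other from the squared ratio minus 1, which is p (2r + p
   r^2). *)
exists (v * (B * (2 * r + p%:R * r ^+ 2))
    + wz_term m * (2 * p%:R * u - 6) * (1 + p%:R * r) ^+ 2).
split; last by rewrite e er ev; ring.
by apply: p_integralD; auto 10 with pint.
Qed.
End Approximation.

(** * Computations in the prime field *)

Lemma prod_ord_neq0 (n : nat) : (0 < n)%N -> (\prod_(j < n | j != 0 :> nat) j)%N = (n.-1)`!.
Proof.
case: n => // n _; rewrite fact_prod /= big_mkcond big_ord_recl /= mul1n big_add1 /= big_mkord.
by apply: eq_bigr.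
Qed.

Lemma prod_nat_last (n : nat) (P : pred nat) (f : nat -> int) : (0 < n)%N ->
  \prod_(0 <= j < n | P j) f j =
  \prod_(0 <= j < n.-1 | P j) f j * (if P n.-1 then f n.-1 else 1).
Proof. by case: n => // n _; rewrite big_mkcond big_nat_recr //= -big_mkcond. Qed.

Section Residues.
Variables (p : nat) (p_pr : prime p).
Local Notation K := 'F_p.

Lemma natr_Fp_eq0 (n : nat) : (n%:R == 0 :> K) = (p %| n)%N.
Proof. by rewrite (dvdn_pcharf (pchar_Fp p_pr)). Qed.

Lemma intr_Fp_eq0 (z : int) : (z%:~R == 0 :> K) = (p %| z)%Z.
Proof. by rewrite (dvdz_pcharf (pchar_Fp p_pr)). Qed.

Lemma natr_p_Fp : p%:R = 0 :> K.
Proof. by apply/eqP; rewrite natr_Fp_eq0. Qed.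

Lemma natr_Fp_inj : injective (fun j : 'I_p => (j : nat)%:R : K).
Proof.
move=> i j /eqP; wlog ij : i j / (i <= j)%N.
  move=> h; case/orP: (leq_total i j) => hij; first exact: h.
  by rewrite eq_sym => e; apply: esym; apply: h.
rewrite eq_sym -subr_eq0 -natrB // natr_Fp_eq0 => hd; apply/eqP; rewrite -val_eqE eqn_leq ij /=.
rewrite leqNgt; apply/negP => hlt; move: hd; rewrite gtnNdvd ?subn_gt0 //.
by have := ltn_ord j; lia.
Qed.

(** An injection between sets of p elements is a bijection, so the product runs over all nonzero
    residues and Wilson's theorem applies. *)
Lemma prod_inj_Fp (f : 'I_p -> K) (j0 : 'I_p) :
  injective f -> f j0 = 0 -> \prod_(j | j != j0) f j = -1.
Proof.
have main (g : 'I_p -> K) (k : 'I_p) : injective g -> g k = 0 ->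
    \prod_(j | j != k) g j = \prod_(x : K | x != 0) x.
  move=> gI gk; rewrite [RHS](reindex g) /=; last first.
    have cK : #|{: K}| = p by apply: card_Fp.
    by apply: onW_bij; apply: inj_card_bij; rewrite // cK card_ord.
  by apply: eq_bigl => j; rewrite -gk (inj_eq gI).
have p0 := prime_gt0 p_pr.
move=> fI f0; rewrite (main f j0) // -(main (fun j => (j : nat)%:R) (Ordinal p0)) //.
  have := p_pr; rewrite (Wilson (prime_gt1 p_pr)) -natr_Fp_eq0 -natr1 addr_eq0 => /eqP <-.
  rewrite -(prod_ord_neq0 p p0) natr_prod.
  by apply: eq_bigl => j; rewrite -val_eqE.
exact: natr_Fp_inj.
Qed.


Lemma prod_lin_Fp (a b : int) (k : nat) :
  b%:~R != 0 :> K -> (k < p)%N -> (a - b * k)%:~R = 0 :> K ->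
  (\prod_(0 <= j < p | j != k) (a - b * j))%:~R = -1 :> K.
Proof.
move=> b0 kp rk; rewrite rmorph_prod big_mkord.
rewrite -(prod_inj_Fp (fun j => (a - b * (j : nat))%:~R) (Ordinal kp)) //.
by move=> i j; rewrite !rmorphB !rmorphM /= => /addrI/oppr_inj/(mulfI b0); apply: natr_Fp_inj.
Qed.

(** The only root modulo p is j = p-1, just outside the range. *)
Lemma prod_lin_root_last (a b : int) :
  b%:~R != 0 :> K -> (a - b * p.-1)%:~R = 0 :> K ->
  (\prod_(0 <= j < p.-1) (a - b * j))%:~R = -1 :> K.
Proof.
move=> b0 r0; have p0 := prime_gt0 p_pr.
rewrite -(prod_lin_Fp _ _ _ b0 _ r0) ?prednK // [in RHS]prod_nat_last //= eqxx mulr1.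
by rewrite [in RHS]big_nat_cond; congr _%:~R; rewrite [LHS]big_nat; apply: eq_bigl => j; lia.
Qed.

(* Here [N] is [s] times the product of all factors [j < p] other than the [k]-th and the
   last one, hence the value of [N] times that last factor. *)
Lemma prod_lin_root (a b s : int) (k : nat) :
  b%:~R != 0 :> K -> (k < p.-1)%N -> a - b * k = p%:Z * s ->
  exists2 N : int, \prod_(0 <= j < p.-1) (a - b * j) = p%:Z * N
    & N%:~R * (a - b * p.-1)%:~R = - s%:~R :> K.
Proof.
move=> b0 kp rk; have p0 := prime_gt0 p_pr.
exists (s * \prod_(0 <= j < p.-1 | j != k) (a - b * j)).
  rewrite mulrA -rk (bigD1_seq k) //= ?mem_index_iota ?iota_uniq //.
have rk0 : (a - b * k)%:~R = 0 :> K by apply/eqP; rewrite rk intr_Fp_eq0 dvdz_mulr.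
have kp' : (k < p)%N by lia.
have := prod_lin_Fp _ _ _ b0 kp' rk0.
rewrite prod_nat_last //= (_ : p.-1 != k); last by lia.
by rewrite !rmorphM /= -mulrA => ->; rewrite mulrN1.
Qed.

(** * Residues of the products divided by p *)

(* The integer [3^(p-1) w_(p-1)(l)]. *)
Definition wzV (l : nat) : int :=
  \prod_(0 <= j < p.-1) ((l%:Z - 1 * j%:Z) * ((3 * l%:Z - 1) - 3 * j%:Z)).

(** The N_k of the idea; the division is exact by [dvd_wzV]. *)
Definition wzN (l : nat) : int := (wzV l %/ p)%Z.

Hypothesis p_gt3 : (3 < p)%N.

Lemma three_Fp_neq0 : 3 != 0 :> K.
Proof. by rewrite (natr_Fp_eq0 3) gtnNdvd. Qed.

Lemma wzN_unique (l : nat) (N : int) : wzV l = p%:Z * N -> wzN l = N.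
Proof. by move=> e; rewrite /wzN e mulKz //; have := prime_gt0 p_pr; lia. Qed.

(** For l = tp + p-1 the factors l-i have their root at i = p-1, out of range, and multiply to -1.
    The factors 3l-1-3i have theirs at i = j, with value p (3t+3-e). *)
Lemma wzN_last (t e j : nat) : (j < p.-1)%N -> (3 * j + 4 = e * p)%N ->
  (p %| wzV (t * p + p.-1))%Z /\
  (wzN (t * p + p.-1))%:~R = - (3 * t%:R + 3 - e%:R) :> K.
Proof.
move=> jp ej; have [l lE] : exists l, l = (t * p + p.-1)%N by eexists.
rewrite -lE.
have p0 := prime_gt0 p_pr.
have lK : l%:R = -1 :> K.
  by apply/eqP; rewrite -addr_eq0 natr1 natr_Fp_eq0 lE -addnS prednK // dvdn_addl // dvdn_mull.
have pK : (p.-1)%:R = -1 :> K.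
  by apply/eqP; rewrite -addr_eq0 natr1 prednK // natr_p_Fp.
have [|N VN eN] := @prod_lin_root (3 * l%:Z - 1) 3 (3 * t%:Z + 3 - e%:Z) j three_Fp_neq0 jp.
  rewrite lE; nia.
have eL : (\prod_(0 <= j < p.-1) (l%:Z - 1 * j%:Z))%:~R = -1 :> K.
  apply: prod_lin_root_last; first by rewrite oner_eq0.
  by rewrite mul1r rmorphB /= -!pmulrn lK pK subrr.
have VE : wzV l = p%:Z * (N * \prod_(0 <= j < p.-1) (l%:Z - 1 * j%:Z)).
  by rewrite /wzV big_split /= VN; ring.
split; first by rewrite VE dvdz_mulr.
rewrite (wzN_unique _ _ VE) rmorphM /= eL mulrN1; congr (- _).
move: eN; rewrite !(rmorphB, rmorphD, rmorphM) /= -!pmulrn lK pK => h.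
by apply: oppr_inj; apply: (etrans _ (etrans h _)); ring.
Qed.

(** The roles are exchanged: the factors l-i vanish modulo p at i = r, with value tp, and the root
    p-1 of the factors 3l-1-3i is out of range. *)
Lemma wzN_mid (t e r : nat) : (r < p.-1)%N -> (3 * r + 2 = e * p)%N ->
  (p %| wzV (t * p + r))%Z /\ (wzN (t * p + r))%:~R = 3 * t%:R :> K.
Proof.
move=> rp er; have [l lE] : exists l, l = (t * p + r)%N by eexists.
rewrite -lE.
have p0 := prime_gt0 p_pr.
have lK : 3 * l%:R = - 2 :> K.
  apply/eqP; rewrite -addr_eq0 -natrM -natrD natr_Fp_eq0 lE.
  by rewrite mulnDr -addnA er mulnA -mulnDl dvdn_mull.
have pK : (p.-1)%:R = -1 :> K.
  by apply/eqP; rewrite -addr_eq0 natr1 prednK // natr_p_Fp.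
have [||N VN eN] := @prod_lin_root l 1 t r _ rp; first by rewrite oner_eq0.
  rewrite lE; nia.
have eL : (\prod_(0 <= j < p.-1) ((3 * l%:Z - 1) - 3 * j%:Z))%:~R = -1 :> K.
  apply: prod_lin_root_last; first exact: three_Fp_neq0.
  rewrite !(rmorphB, rmorphM) /= -!pmulrn pK lK; ring.
have VE : wzV l = p%:Z * (N * \prod_(0 <= j < p.-1) ((3 * l%:Z - 1) - 3 * j%:Z)).
  by rewrite /wzV big_split /= VN; ring.
split; first by rewrite VE dvdz_mulr.
rewrite (wzN_unique _ _ VE) rmorphM /= eL mulrN1.
move: eN; rewrite !(rmorphB, rmorphM) /= -!pmulrn pK => eN.
have -> : t%:R = - (N%:~R * (l%:R - 1 * -1)) :> K by rewrite eN opprK.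
transitivity (- (N%:~R * (3 * l%:R + 3)) : K); last by ring.
by rewrite lK; ring.
Qed.

(** Both families of factors have a root in range, so p^2 divides [wzV]. *)
Lemma wzN_other (t r : nat) : (r < p.-1)%N -> ~~ (p %| 3 * r + 2)%N ->
  (p %| wzV (t * p + r))%Z /\ (wzN (t * p + r))%:~R = 0 :> K.
Proof.
move=> rp er; have [l lE] : exists l, l = (t * p + r)%N by eexists.
rewrite -lE.
have p0 := prime_gt0 p_pr.
have [||N VN _] := @prod_lin_root l 1 t r _ rp; first by rewrite oner_eq0.
  rewrite lE; nia.
pose x : K := (3 * l%:R - 1) / 3; pose j : nat := x.
have jx : j%:R = x by exact: natr_Zp.
have jp : (j < p)%N by rewrite /j -[p in (_ < p)%N](card_Fp p_pr) card_ord ltn_ord.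
have dj : (p %| (3 * l%:Z - 1) - 3 * j%:Z)%Z.
  rewrite -intr_Fp_eq0 !(rmorphB, rmorphM) /= -!pmulrn jx /x mulrCA mulfV ?three_Fp_neq0 //.
  by rewrite mulr1 subrr.
(* A root at p-1 would give 3l-1+3 = 3l+2 = 0 modulo p, which the hypothesis on r excludes. *)
have jp' : (j < p.-1)%N.
  rewrite ltn_neqAle -ltnS prednK // jp andbT; apply/negP => /eqP ej.
  move/negP: er; apply; rewrite -natr_Fp_eq0.
  move: dj; rewrite ej -intr_Fp_eq0 !(rmorphB, rmorphM) /= -!pmulrn => /eqP h.
  have pK : (p.-1)%:R = -1 :> K.
    by apply/eqP; rewrite -addr_eq0 natr1 prednK // natr_p_Fp.
  rewrite pK lE !(natrD, natrM) natr_p_Fp in h *.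
  by apply/eqP; rewrite -h; ring.
have [s es] := dvdzP dj.
have [|M VM _] := @prod_lin_root (3 * l%:Z - 1) 3 s j three_Fp_neq0 jp'; first by rewrite es mulrC.
have VE : wzV l = p%:Z * (p%:Z * (N * M)).
  by rewrite /wzV big_split /= VN VM; ring.
split; first by rewrite VE dvdz_mulr.
by apply/eqP; rewrite (wzN_unique _ _ VE) intr_Fp_eq0 dvdz_mulr.
Qed.

Lemma prime_mod3 :
  (exists2 n, p = (3 * n).+1 & (0 < n)%N) \/ exists2 n, p = (3 * n).+2 & (0 < n)%N.
Proof.
have h3 : ~~ (3 %| p)%N by rewrite dvdn_prime2 //; lia.
have : (p %% 3 = 1 \/ p %% 3 = 2)%N by move: h3; lia.
by case=> h; [left | right]; exists (p %/ 3)%N; lia.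
Qed.

Lemma dvd_wzV (l : nat) : (p %| wzV l)%Z.
Proof.
have p0 := prime_gt0 p_pr.
rewrite (divn_eq l p); have := ltn_pmod l p0; move: (_ %/ _)%N (_ %% _)%N => t r rp.
have [rlt|rge] := ltnP r p.-1.
  case: (boolP (p %| 3 * r + 2)%N) => [/dvdnP[e er]|h].
    by have [] := wzN_mid t e r rlt er.
  by have [] := wzN_other t r rlt h.
have -> : r = p.-1 by lia.
(* The equation 3j+4 = ep has the solution j = n-1, e = 1 for p = 3n+1, and j = 2n, e = 2 for p =
   3n+2. *)
case: prime_mod3 => -[n pn n0].
  by have [||] := wzN_last t 1 n.-1; [lia..|].
by have [||] := wzN_last t 2 (2 * n)%N; [lia..|].
Qed.

(** * Summation over blocks of p consecutive integers *)

(* The residue of [F(p-1,l) / (a p)]. *)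
Definition wz_res (l : nat) : K := (6 * l%:R + 5) * (wzN l)%:~R ^+ 2.

(** Since l = -1 modulo p, the weight 6l+5 is -1. *)
Lemma wz_res_last (t e j : nat) : (j < p.-1)%N -> (3 * j + 4 = e * p)%N ->
  wz_res (t * p + p.-1) = - (3 * t%:R + 3 - e%:R) ^+ 2.
Proof.
move=> jp ej; have [_ e1] := wzN_last t e j jp ej.
have p0 := prime_gt0 p_pr.
have pK : (p.-1)%:R = -1 :> K.
  by apply/eqP; rewrite -addr_eq0 natr1 prednK // natr_p_Fp.
by rewrite /wz_res e1 natrD natrM pK natr_p_Fp //; ring.
Qed.

(** Since 3l = -2 modulo p, the weight 6l+5 is 1. *)
Lemma wz_res_mid (t e r : nat) : (r < p.-1)%N -> (3 * r + 2 = e * p)%N ->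
  wz_res (t * p + r) = (3 * t%:R) ^+ 2.
Proof.
move=> rp er; have [_ e1] := wzN_mid t e r rp er.
have h : 3 * r%:R + 2 = 0 :> K by rewrite -natrM -natrD er natrM natr_p_Fp // mulr0.
have h' : 3 * r%:R = - 2 :> K by apply/eqP; rewrite -addr_eq0 h.
rewrite /wz_res e1 natrD natrM natr_p_Fp // mulr0 add0r.
transitivity ((2 * (3 * r%:R) + 5) * (3 * t%:R) ^+ 2 : K); first by ring.
by rewrite h'; ring.
Qed.

Lemma wz_res_other (t r : nat) : (r < p.-1)%N -> ~~ (p %| 3 * r + 2)%N ->
  wz_res (t * p + r) = 0.
Proof.
move=> rp er; have [_ e1] := wzN_other t r rp er.
by rewrite /wz_res e1 expr0n mulr0.
Qed.

Lemma dvd_3r2_unique (r s : nat) : (r < p)%N -> (s < p)%N ->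
  (p %| 3 * r + 2)%N -> (p %| 3 * s + 2)%N -> r = s.
Proof.
move=> rp sp; rewrite -!(natr_Fp_eq0) => /eqP hr /eqP hs.
have : 3 * r%:R = 3 * s%:R :> K.
  by rewrite -!natrM; apply: (@addIr _ 2); rewrite -!natrD hr hs.
move/(mulfI (three_Fp_neq0 )) => e.
by have [] := natr_Fp_inj (Ordinal rp) (Ordinal sp) e.
Qed.

Lemma wz_res_block (t e j e' r : nat) :
  (j < p.-1)%N -> (3 * j + 4 = e * p)%N -> (r < p.-1)%N -> (3 * r + 2 = e' * p)%N ->
  \sum_(t * p <= l < t.+1 * p) wz_res l = (3 * t%:R) ^+ 2 - (3 * t%:R + 3 - e%:R) ^+ 2.
Proof.
move=> jp ej rp er; have p0 := prime_gt0 p_pr.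
rewrite -{1}[(t * p)%N]add0n big_addn mulSn addnK.
have last_term (m : nat) (f : nat -> K) : (0 < m)%N ->
    \sum_(0 <= i < m) f i = \sum_(0 <= i < m.-1) f i + f m.-1.
  by case: m => // m _; rewrite big_nat_recr.
rewrite last_term //.
rewrite [(p.-1 + _)%N]addnC (wz_res_last t e j jp ej); congr (_ + _).
rewrite (bigD1_seq r) ?mem_index_iota ?iota_uniq //= addnC (wz_res_mid t e' r rp er).
rewrite big1_seq ?addr0 // => s /andP[sr]; rewrite mem_index_iota => /andP[_ sp].
rewrite addnC wz_res_other //; apply: contra sr => hs; apply/eqP.
by apply: dvd_3r2_unique; rewrite ?er ?dvdn_mull //; lia.
Qed.

(** A segment that stops before r also stops before p-1, so it meets neither contributing
    position. *)
Lemma wz_res_small (t e r n : nat) : (n <= r)%N -> (r < p)%N -> (3 * r + 2 = e * p)%N ->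
  \sum_(t * p <= l < t * p + n) wz_res l = 0.
Proof.
move=> nr rp er; rewrite -{1}[(t * p)%N]add0n big_addn addKn.
rewrite big1_seq // => s /andP[_]; rewrite mem_index_iota => /andP[_ sp].
rewrite addnC wz_res_other //; first by lia.
apply/negP => hs; suff : s = r by lia.
by apply: dvd_3r2_unique; rewrite ?er ?dvdn_mull //; lia.
Qed.

(** The factor 3 makes the sum a polynomial in 3n, where n is the number of full blocks and 3n is -1
    or -2 modulo p. *)
Lemma wz_res_sum :
  3 * \sum_(0 <= l < (p ^ 2 - 1) %/ 3) wz_res l = - 4 * (legendre3 p)%:~R.
Proof.
have split2 (t n : nat) : \sum_(0 <= l < t * p + n) wz_res l =
    \sum_(0 <= i < t) \sum_(i * p <= l < i.+1 * p) wz_res l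
    + \sum_(t * p <= l < t * p + n) wz_res l.
  by rewrite (@big_cat_nat _ _ _ (t * p)%N) ?leq_addr //= big_nat_mul.
have pK := natr_p_Fp.
case: prime_mod3 => -[n pn n0].
(* There are n full blocks; the remaining n terms stop before the position r = 2n, where 3r+2 =
   2p. *)
- have -> : ((p ^ 2 - 1) %/ 3 = n * p + n)%N by nia.
  have -> : legendre3 p = 1 by rewrite /legendre3 (_ : p %% 3 = 1)%N //; lia.
  rewrite split2 (@wz_res_small n 2 (2 * n)) ?addr0; [|lia..].
  have blk i : \sum_(i * p <= l < i.+1 * p) wz_res l = (3 * i%:R) ^+ 2 - (3 * i%:R + 3 - 1) ^+ 2.
    by apply: (@wz_res_block i 1 n.-1 2 (2 * n)); lia.
  under eq_bigr => i _ do rewrite blk.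
  have nK : 3 * n%:R = -1 :> K by apply/eqP; rewrite -addr_eq0 -natrM natr1 -pn pK.
  have -> (m : nat) : \sum_(0 <= i < m) ((3 * i%:R) ^+ 2 - (3 * i%:R + 3 - 1) ^+ 2)
      = - 6 * m%:R ^+ 2 + 2 * m%:R :> K.
    elim: m => [|m IH]; first by rewrite big_geq //; ring.
    by rewrite big_nat_recr //= IH -natr1; ring.
  transitivity (- 2 * (3 * n%:R) ^+ 2 + 2 * (3 * n%:R) : K); first by ring.
  by rewrite nK; ring.
(* The last 2n+1 terms contain the position r = n, where 3r+2 = p, but not p-1 = 3n+1. *)
- have -> : ((p ^ 2 - 1) %/ 3 = n * p + n.+1 + n)%N by nia.
  have -> : legendre3 p = -1 by rewrite /legendre3 (_ : p %% 3 = 2)%N //; lia.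
  rewrite -addnA split2.
  have blk i : \sum_(i * p <= l < i.+1 * p) wz_res l = (3 * i%:R) ^+ 2 - (3 * i%:R + 3 - 2) ^+ 2.
    by apply: (@wz_res_block i 2 (2 * n) 1 n); lia.
  have -> : \sum_(n * p <= l < n * p + (n.+1 + n)) wz_res l = (3 * n%:R) ^+ 2.
    rewrite -{1}[(n * p)%N]add0n big_addn addKn.
    rewrite (bigD1_seq n) ?mem_index_iota ?iota_uniq //=; last by lia.
    rewrite big1_seq ?addr0 => [|s /andP[sn]].
      by rewrite addnC (wz_res_mid n 1 n) //; lia.
    rewrite mem_index_iota => /andP[_ sp]; rewrite addnC wz_res_other //; first by lia.
    apply: contra sn => hs; apply/eqP.
    by apply: dvd_3r2_unique => //; try lia; rewrite (_ : 3 * n + 2 = p)%N //; lia.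
  under eq_bigr => i _ do rewrite blk.
  have nK : 3 * n%:R = -2 :> K by apply/eqP; rewrite -addr_eq0 -natrM -natrD addn2 -pn pK.
  have -> (m : nat) : \sum_(0 <= i < m) ((3 * i%:R) ^+ 2 - (3 * i%:R + 3 - 2) ^+ 2)
      = - 3 * m%:R ^+ 2 + 2 * m%:R :> K.
    elim: m => [|m IH]; first by rewrite big_geq //; ring.
    by rewrite big_nat_recr //= IH -natr1; ring.
  transitivity (2 * (3 * n%:R) ^+ 2 + 2 * (3 * n%:R) : K); first by ring.
  by rewrite nK; ring.
Qed.


(** * The leading coefficient of F(p-1,k) *)

Lemma wz_prod_wzV (l : nat) : wz_prod l%:R p.-1 = (wzV l)%:~R / 3 ^+ p.-1.
Proof.
rewrite /wz_prod /wzV; elim: p.-1 => [|m IH]; first by rewrite !big_geq // expr0 divr1.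
rewrite !big_nat_recr //= IH exprS !(rmorphM, rmorphB) /= -!pmulrn.
by field; rewrite expf_neq0.
Qed.

(** This is the constant a of the idea. With n = p-1 it simplifies to 3 (-3)^n / (n!^3 W), where W =
    (2p+1)...(3p-2) is (p-2)! = 1 modulo p; Fermat and Wilson give the rest. *)
Lemma wz_lead_coef_modp : exists2 r, p_integral p r &
  6 * wz_coef p.-1 * (2 * p.-1%:R + 1) * p%:R / 9 ^+ p.-1 = p%:R * r - 3.
Proof.
have p0 := prime_gt0 p_pr; have pK := natr_p_Fp.
pose n := p.-1; pose W := ((3 * n).+1 ^_ n.-1)%N.
have nK : n%:R = -1 :> K by apply/eqP; rewrite -addr_eq0 natr1 /n prednK // pK.
have fK : n`!%:R = -1 :> K.
  by have := p_pr; rewrite (Wilson (prime_gt1 p_pr)) -(natr_Fp_eq0) -natr1 addr_eq0 => /eqP.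
have WK : W%:R = 1 :> K.
  have -> : W%:R = (n.-1)`!%:R :> K.
    rewrite -ffactnn /W !ffact_prod !natr_prod; apply: eq_bigr => -[i /= hi] _.
    have -> : ((3 * n).+1 - i = 2 * p + (n.-1 - i))%N by rewrite /n in hi *; lia.
    by rewrite natrD natrM pK mulr0 add0r.
  have n0 : (0 < n)%N by rewrite /n; lia.
  by apply: oppr_inj; rewrite -fK -[in RHS](prednK n0) factS prednK // natrM nK mulN1r.
have m3K : (-3) ^+ n = 1 :> K.
  have h3 : -3 != 0 :> K by rewrite oppr_eq0 three_Fp_neq0.
  have cK : #|{: K}| = p by apply: card_Fp.
  apply: (mulfI h3); rewrite -exprS prednK // mulr1.
  by have := expf_card (-3 : K); rewrite cK.
have : (p %| (-3) ^+ n + (n`! ^ 3 * W)%N%:Z)%Z.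
  rewrite -(intr_Fp_eq0) rmorphD rmorphXn /= -pmulrn natrM natrX fK WK.
  by apply/eqP; transitivity ((-3) ^+ n - 1 : K); [ring | rewrite m3K subrr].
case/dvdzP => s es.
have d0 : (0 < n`! ^ 3 * W)%N.
  by rewrite muln_gt0 expn_gt0 fact_gt0 ffact_gt0 /n; lia.
(* From a + 3 = 3 ((-3)^n + n!^3 W) / (n!^3 W), whose bracket is sp. *)
exists ((3 * s)%:~R / (n`! ^ 3 * W)%N%:R).
  apply: p_integral_div => //; rewrite coprime_sym prime_coprime // -(natr_Fp_eq0).
  by rewrite natrM natrX fK WK mulr1 -signr_odd expr1 oppr_eq0 oner_eq0.
have dN : (n`! ^ 3 * W)%N%:R != 0 :> rat by rewrite pnatr_eq0 -lt0n.
apply: (mulIf dN); rewrite [RHS]mulrBl -[X in _ = X - _]mulrA mulfVK //.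
have -> : p%:R * (3 * s)%:~R = 3 * ((-3) ^+ n + (n`! ^ 3 * W)%:R) :> rat.
  have := congr1 (fun z : int => z%:~R : rat) es.
  by rewrite rmorphD rmorphXn /= => ->; rewrite !rmorphM /=; ring.
have eW : ((3 * n).+1`! = W * (2 * p * (2 * n).+1 * (2 * n)`!))%N.
  rewrite -(@ffact_fact (3 * n).+1 n.-1); last by lia.
  rewrite -/W (_ : (3 * n).+1 - n.-1 = (2 * n).+2)%N; last by rewrite /n; lia.
  by rewrite !factS (_ : (2 * n).+2 = 2 * p)%N ?mulnA // /n; lia.
have pN : p%:R != 0 :> rat by rewrite pnatr_eq0 -lt0n.
have h1 := natr_fact_neq0 n; have h2 := natr_fact_neq0 (2 * n).
have WN : W%:R != 0 :> rat by move: d0; rewrite pnatr_eq0 -lt0n muln_gt0 => /andP[].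
have h4 : 2 * n%:R + 1 != 0 :> rat by apply: lt0r_neq0; have := ler0n rat n; lra.
have e27 : (-27) ^+ n = (-3) ^+ n * 9 ^+ n :> rat by rewrite -exprMn; congr (_ ^+ _); ring.
rewrite -/n /wz_coef eW e27 -addn1 !(natrM, natrX, natrD).
by field; rewrite h1 h2 WN pN [1 + _]addrC h4 expf_neq0.
Qed.

End Residues.

Theorem theorem9 (p : nat) (hp : prime p) (hp3 : (3 < p)%N) :
  congr_Zp p
    (\sum_(0 <= k < p)
        ((15 * k + 4)%:R / (-27 : rat) ^+ k) * ('C(2 * k, k) ^ 2 * 'C(3 * k, k))%:R)
    (4 * (legendre3 p)%:~R * p%:R)
    ((p ^ 2)%N)%:R.
Proof.
have p0 := prime_gt0 hp.
pose l := ((p ^ 2 - 1) %/ 3)%N.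
have zl : (p%:R ^+ 2 - 1) / 3 = l%:R :> rat.
  have e : (p ^ 2 = 3 * l + 1)%N.
    by rewrite /l; case: (prime_mod3 p hp hp3) => -[n -> _]; nia.
  by rewrite -natrX e natrD natrM; field.
have [q [hq eq]] := congr_Zp_sum p (p%:R ^+ 2) p _ _ (wzG_approx p hp ^~ hp3).
have [r hr er] := wz_lead_coef_modp p hp hp3.
(* The sum of F(p-1,k) over k < l is a p Z, so Z matters only modulo p. *)
pose Z : int := \sum_(0 <= k < l) (6 * k%:Z + 5 - 3 * p%:Z) * wzN p k ^+ 2.
have [s es] : exists s : int, 3 * Z + 4 * legendre3 p = s * p%:Z.
  apply/dvdzP; rewrite -(intr_Fp_eq0 p hp) rmorphD !rmorphM /=.
  have -> : Z%:~R = \sum_(0 <= k < l) wz_res p k :> 'F_p.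
    rewrite rmorph_sum; apply: eq_bigr => k _.
    rewrite /wz_res !(rmorphM, rmorphB, rmorphD, rmorphXn) /= -!pmulrn natr_p_Fp //.
    by ring.
  by rewrite wz_res_sum //; apply/eqP; ring.
have eF : \sum_(0 <= m < p) wzG m l%:R = p%:R * (p%:R * r - 3) * Z%:~R.
  rewrite -{1}(prednK p0) wzG_sum_nat rmorph_sum mulr_sumr; apply: eq_bigr => k _.
  rewrite -er /wzF wz_prod_wzV.
  have -> : wzV p k = p%:Z * wzN p k by rewrite mulrC divzK // dvd_wzV.
  rewrite !(rmorphM, rmorphB, rmorphD, rmorphXn) /= -!pmulrn.
  have -> : (p.-1)%:R = p%:R - 1 :> rat by rewrite -[p in RHS](prednK p0) -natr1 addrK.
  have -> : 9 ^+ p.-1 = (3 ^+ p.-1) ^+ 2 :> rat by rewrite -exprM mulnC exprM; congr (_ ^+ _).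
  by field; rewrite expf_neq0.
(* With a = pr - 3, a p Z is p^2 r Z - 3pZ, and 3Z = sp - 4 (p/3); q is the error of the change of
   point. *)
exists (r * Z%:~R - s%:~R - q); split.
  by rewrite -/(p_integral p _); have : p_integral p q := hq; auto with pint.
have -> : \sum_(0 <= k < p) (15 * k + 4)%:R / (-27) ^+ k * ('C(2 * k, k) ^ 2 * 'C(3 * k, k))%:R
  = \sum_(0 <= k < p) (15 * k + 4)%:R * wz_term k.
  by apply: eq_bigr => k _; rewrite /wz_term mulrAC mulrA.
rewrite natrX mulrBr -eq zl eF.
have es' := congr1 (fun z : int => z%:~R : rat) es.
rewrite !(rmorphD, rmorphM) /= in es'.
transitivity (p%:R ^+ 2 * r * Z%:~R - p%:R * (3 * Z%:~R + 4 * (legendre3 p)%:~R)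
   - (p%:R * (p%:R * r - 3) * Z%:~R - \sum_(0 <= k < p) (15 * k + 4)%:R * wz_term k)).
  by ring.
by rewrite es' -!pmulrn; ring.
Qed.
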